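(* Let $M$ and $V$ be finite-dimensional real representation spaces of a finite group $\Gamma$. Let $\phi$ be a $\Gamma$-equivariant linear map from $M$ onto $V$. Suppose that $A \in \mathcal{A}(M)$ satisfies: (1) $T(A)$ is an isotropy subgroup for the action of $\Gamma$ on $V$; (2) there exists $a \in A$ such that $\Sigma(a) = T(A)$ (fix such an $a$). Then for each positive integer $k$ there exists an open dense set $\mathcal{O} \subseteq C^k_\Gamma(M)$ such that, for all $\psi \in \mathcal{O}$, $$\Sigma(\phi(\psi(a))) = \Sigma(a), \qquad T(\phi(\psi(A))) = T(A), \qquad \Sigma(\phi(\psi(A))) = \Sigma(A).$$
   Context: A real representation space of a finite group $\Gamma$ is a real vector space with a linear action of $\Gamma$. A map $f$ between spaces with $\Gamma$-actions is $\Gamma$-equivariant if $f(\gamma x)=\gamma f(x)$ for all $\gamma\in\Gamma$ and all $x$. For a point $x$, $\Sigma(x)=\{\gamma\in\Gamma \mid \gamma x = x\}$. A subgroup $H\le\Gamma$ is an isotropy subgroup for the action on $V$ if $H=\Sigma(v)$ for some $v\in V$. For a subset $A$, $T(A)=\{\gamma\in\Gamma\mid \gamma x=x \ \forall x\in A\}$ (pointwise symmetry) and $\Sigma(A)=\{\gamma\in\Gamma\mid \gamma A=A\}$ (setwise symmetry), where $\gamma A=\{\gamma x\mid x\in A\}$. Define $$\mathcal{A}(M)=\{A\subseteq M \mid A \text{ is compact and, for every } \gamma\in\Gamma,\ \gamma A=A \text{ or } \gamma A\cap A=\emptyset\}.$$ $C^k_\Gamma(M)$ is the set of $k$-times continuously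 differentiable $\Gamma$-equivariant maps $M\to M$, with the strong (Whitney) $C^k$ topology: a base of neighborhoods of $\psi$ is given by the sets $\{\tilde\psi\in C^k_\Gamma(M) \mid \|D^{(j)}\tilde\psi(x)-D^{(j)}\psi(x)\|<\varepsilon(x)\ \forall x\in M,\ 0\le j\le k\}$, where $\varepsilon:M\to(0,\infty)$ ranges over continuous functions. *)

(* Defs.v *)
From HB Require Import structures.
From mathcomp Require Import all_boot all_order all_algebra all_fingroup.
From mathcomp Require Import mxrepresentation.
From mathcomp Require Import all_classical all_reals all_analysis.

Set Implicit Arguments.
Unset Strict Implicit.
Unset Printing Implicit Defensive.

Import Order.TTheory GRing.Theory Num.Theory.
Import numFieldNormedType.Exports.
Local Open Scope classical_set_scope.
Local Open Scope ring_scope.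

(* An n-dimensional real representation of the finite group G is an           *)
(* [mx_representation R G n]. The group acts on the left on column vectors:   *)
(* since rG (g * h) = rG g *m rG h, one has (g * h) x = g (h x).              *)

Section Action.
Context (R : realType) (gT : finGroupType) (G : {group gT}) (n : nat).
Variable rG : mx_representation R G n.

Definition actv (g : gT) (x : 'cV[R]_n) : 'cV[R]_n := rG g *m x.

Definition stab (x : 'cV[R]_n) : {set gT} := [set g in G | actv g x == x].

Definition isotropy_subgroup (H : {set gT}) : Prop := exists v, H = stab v.

Definition pointwise_symm (A : set 'cV[R]_n) : {set gT} :=
  [set g in G | `[< forall x, A x -> actv g x = x >]].

Definition setwise_symm (A : set 'cV[R]_n) : {set gT} :=
  [set g in G | `[< actv g @` A = A >]].

Definition calA : set (set 'cV[R]_n) :=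
  [set A | compact A /\
     forall g, g \in G -> actv g @` A = A \/ actv g @` A `&` A = set0].

End Action.

Definition equivariant (R : realType) (gT : finGroupType) (G : {group gT})
    (m n : nat) (rM : mx_representation R G m) (rV : mx_representation R G n)
    (f : 'cV[R]_m -> 'cV[R]_n) : Prop :=
  forall g x, g \in G -> f (actv rM g x) = actv rV g (f x).

Section Derivatives.
Context (R : realType) (M W : normedModType R).
Implicit Types f : M -> W.

(* The j-th Frechet derivative, as a j-linear map:                            *)
(*   D^(j+1) f(x)(v, v1, .., vj) = (D(D^(j) f)(x) v)(v1, .., vj).             *)
Fixpoint iterD f (vs : seq M) : M -> W :=
  if vs is v :: vs' then fun x => 'd (iterD f vs') x v else f.

Definition Dn (j : nat) f (x : M) (vs : j.-tuple M) : W := iterD f vs x.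
Arguments Dn : clear implicits.

(* For finite-dimensional M, the space of j-linear maps from M to W carries   *)
(* the topology of pointwise convergence, so differentiability and continuity *)
(* of x |-> D^(j) f(x) can be tested on fixed arguments v1, .., vj.           *)
Definition Ck (k : nat) f : Prop :=
  (forall j (vs : j.-tuple M), (j < k)%N ->
     forall x, differentiable (fun y => Dn j f y vs) x) /\
  (forall j (vs : j.-tuple M), (j <= k)%N -> continuous (fun y => Dn j f y vs)).

(* Operator norm of a j-linear map, a priori possibly infinite. *)
Definition opnorm (j : nat) (T : j.-tuple M -> W) : \bar R :=
  ereal_sup [set (`|T vs|)%:E | vs in
    [set vs : j.-tuple M | forall i, `|tnth vs i| <= 1]].

Lemma opnorm_ltP j (T : j.-tuple M -> W) (vs : j.-tuple M) (e : R) :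
  (opnorm T < e%:E)%E -> (forall i, `|tnth vs i| <= 1) -> `|T vs| < e.
Proof.
move=> Te vs1; rewrite -lte_fin; apply: le_lt_trans Te.
by apply: ereal_sup_ubound; exists vs.
Qed.

Lemma opnorm0_lt j (e : R) : 0 < e ->
  (opnorm (fun _ : j.-tuple M => (0 : W)%R) < e%:E)%E.
Proof.
move=> e0; apply: (@le_lt_trans _ _ 0%E); last by rewrite lte_fin.
by apply: ge_ereal_sup => _ [vs _ <-]; rewrite normr0.
Qed.

Lemma opnormD_lt j (S T : j.-tuple M -> W) (d e : R) :
  (opnorm S < d%:E)%E -> (opnorm T < e%:E)%E ->
  (opnorm (fun vs => (S vs + T vs)%R) < (d + e)%:E)%E.
Proof.
move=> Sd Te; apply: (@le_lt_trans _ _ (opnorm S + opnorm T)%E).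
  apply: ge_ereal_sup => _ [vs vs1 <-].
  apply: (@le_trans _ _ ((`|S vs|)%:E + (`|T vs|)%:E)%E).
    by rewrite -EFinD lee_fin ler_normD.
  by apply: leeD; apply: ereal_sup_ubound; exists vs.
by rewrite EFinD; apply: lteD.
Qed.

End Derivatives.
Arguments Dn {R M W} j f x vs.

Section StrongTopology.
Context (R : realType) (gT : finGroupType) (G : {group gT}) (m : nat).
Variables (rM : mx_representation R G m) (k : nat).

Record equivCk := EquivCk {
  equivCk_fun :> 'cV[R]_m -> 'cV[R]_m ;
  equivCk_Ck : Ck k equivCk_fun ;
  equivCk_equivariant : equivariant rM rM equivCk_fun }.

(* The matrix norm of the library is the sup norm; the resulting topology     *)
(* does not depend on the choice of a norm.                                   *)
Definition strong_basic_nbhs (psi : equivCk) (e : 'cV[R]_m -> R) :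
    set equivCk :=
  [set psi' : equivCk | forall x j, (j <= k)%N ->
     (opnorm (fun vs => (Dn j psi' x vs - Dn j psi x vs)%R) < (e x)%:E)%E].

Definition strong_nbhs (psi : equivCk) : set_system equivCk :=
  filter_from [set e : 'cV[R]_m -> R | continuous e /\ forall x, 0 < e x]
              (strong_basic_nbhs psi).

HB.instance Definition _ := gen_eqMixin equivCk.
HB.instance Definition _ := gen_choiceMixin equivCk.
HB.instance Definition _ := hasNbhs.Build equivCk strong_nbhs.

Let strong_nbhs_filter psi : ProperFilter (strong_nbhs psi).
Proof.
have subset_min e1 e2 : strong_basic_nbhs psi (fun x => Num.min (e1 x) (e2 x))
    `<=` strong_basic_nbhs psi e1 `&` strong_basic_nbhs psi e2.
  move=> psi' H; split=> x j jk; apply: (lt_le_trans (H x j jk));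
    by rewrite lee_fin ge_min lexx ?orbT.
apply: filter_from_proper; last first.
  move=> e [_ e0]; exists psi => x j _.
  under [X in opnorm X]funext do rewrite subrr.
  exact: opnorm0_lt.
apply: filter_from_filter.
  by exists (fun=> 1); split=> // x; exact: cst_continuous.
move=> e1 e2 [c1 p1] [c2 p2].
exists (fun x => Num.min (e1 x) (e2 x)); last exact: subset_min.
split=> [x|x]; last by rewrite lt_min p1 p2.
by apply: continuous_min; [exact: c1|exact: c2].
Qed.

Let strong_nbhs_singleton psi (U : set equivCk) : strong_nbhs psi U -> U psi.
Proof.
move=> [e [_ e0]]; apply=> x j _.
under [X in opnorm X]funext do rewrite subrr.
exact: opnorm0_lt.
Qed.

Let strong_nbhs_nbhs psi (U : set equivCk) :
  strong_nbhs psi U -> strong_nbhs psi (strong_nbhs^~ U).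
Proof.
move=> [e [ce e0] eU].
have half : [set e : 'cV[R]_m -> R | continuous e /\ forall x, 0 < e x]
    (fun x => e x / 2).
  split=> [x|x]; last by rewrite divr_gt0.
  by apply: (cvgM (ce x)); exact: cvg_cst.
exists (fun x => e x / 2) => // psi1 H1; exists (fun x => e x / 2) => //.
move=> psi2 H2; apply: eU => x j jk.
have := opnormD_lt (H2 x j jk) (H1 x j jk); rewrite -splitr.
by under [X in opnorm X]funext do rewrite addrA subrK.
Qed.

HB.instance Definition _ := Nbhs_isNbhsTopological.Build equivCk
  strong_nbhs_filter strong_nbhs_singleton strong_nbhs_nbhs.

End StrongTopology.

(* Main.v *)
(* Write T = T(A) = Sigma(a) and let O be the set of psi such that no element of
   G \ T fixes phi(psi(a)) and, for every g outside Sigma(A), some g phi(psi(x))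
   with x in A avoids phi(psi(A)). Both conditions survive a uniformly small
   perturbation because A is compact. The first one becomes true after adding a
   small multiple of an equivariant bump P at a with phi(P(a)) a nonzero multiple
   of a vector of V with isotropy T.
   For the second one, let N be the G-invariant continuous homogeneous function
   on V that, on T-fixed vectors, is positive exactly where the isotropy is T, and
   let x maximize N o phi o psi on A. Replacing psi by (1 + c rho) psi, where rho
   is a G-invariant bump equal to 1 on the orbit of x and less than 1 elsewhere,
   makes the orbit of x the only place of A where the maximum is reached. So
   g phi(psi(x)) = phi(psi(z)) with z in A forces z = hx with h in G, hence
   h^-1 g in T, gx = hx in A and gA = A. *)

Require Import Defs.
From HB Require Import structures.
From mathcomp Require Import all_boot all_order all_algebra all_fingroup.
From mathcomp Require Import mxrepresentation.
From mathcomp Require Import all_classical all_reals all_analysis.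
From mathcomp Require Import ring lra.

Set Implicit Arguments.
Unset Strict Implicit.
Unset Printing Implicit Defensive.

Import Order.TTheory GRing.Theory Num.Theory.
Import numFieldNormedType.Exports.
Local Open Scope classical_set_scope.
Local Open Scope ring_scope.

(* [ssrnat.iterD] shadows the iterated derivative. *)
Local Notation iterD := Defs.iterD.

(** * Calculus of C^k maps *)

Section IteratedDerivatives.
Context (R : realType) (M W : normedModType R).
Implicit Types (f g : M -> W) (r : M -> R).

(** The head of the list is the outermost derivative and the last entry the innermost. Peeling off
    the last entry replaces [f] by a first derivative, which is what inductions on the order
    require. *)
Lemma iterD_rcons f vs v :
  iterD f (rcons vs v) = iterD (fun x => 'd f x v) vs.
Proof. by elim: vs => //= u vs ->. Qed.

Lemma Ck_seqP k f : Ck k f <->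
  (forall vs, (size vs < k)%N -> forall x, differentiable (iterD f vs) x) /\
  (forall vs, (size vs <= k)%N -> continuous (iterD f vs)).
Proof.
split=> [[fd fc]|[fd fc]]; split=> [vs vsk|vs vsk].
- by have := fd _ (in_tuple vs) vsk.
- by have := fc _ (in_tuple vs) vsk.
- by move=> jk x; apply: fd; rewrite size_tuple.
- by move=> jk; apply: fc; rewrite size_tuple.
Qed.

Lemma Ck0P f : Ck 0 f <-> continuous f.
Proof.
split=> [/Ck_seqP[_ /(_ [::] isT)]//|fc]; apply/Ck_seqP.
by split=> // -[|//].
Qed.

(** Recursive description of [Ck], from which the closure properties below follow by induction on
    [k]. *)
Lemma CkSP k f : Ck k.+1 f <->
  (forall x, differentiable f x) /\ forall v, Ck k (fun x => 'd f x v).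
Proof.
split=> [/Ck_seqP[fd fc]|[fd fC]].
  split=> [x|v]; first by have := fd [::] isT x.
  by apply/Ck_seqP; split=> vs vsk; rewrite -iterD_rcons;
    [apply: fd|apply: fc]; rewrite size_rcons.
apply/Ck_seqP; split=> vs.
  elim/last_ind: vs => [//|vs v _]; rewrite size_rcons iterD_rcons => vsk.
  by have /Ck_seqP[+ _] := fC v; apply.
elim/last_ind: vs => [_ x|vs v _].
  exact/differentiable_continuous.
rewrite size_rcons iterD_rcons => vsk.
by have /Ck_seqP[_] := fC v; apply.
Qed.

Lemma Ck_continuous k f : Ck k f -> continuous f.
Proof. by move=> /Ck_seqP[_ /(_ [::] isT)]. Qed.

Lemma CkW k f : Ck k.+1 f -> Ck k f.
Proof.
move=> /Ck_seqP[fd fc]; apply/Ck_seqP; split=> vs vsk; [apply: fd|apply: fc];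
  exact: leqW.
Qed.

Lemma Ck_cst k (w : W) : Ck k (fun _ : M => w).
Proof.
elim: k w => [|k IH] w; first by apply/Ck0P; exact: cst_continuous.
apply/CkSP; split=> [x|v]; first exact: differentiable_cst.
rewrite (_ : (fun x => _) = fun=> 0) //.
by apply/funext => x; rewrite diff_cst.
Qed.

Lemma CkD k f g : Ck k f -> Ck k g -> Ck k (fun x => f x + g x).
Proof.
elim: k f g => [|k IH] f g.
  by move=> /Ck0P fc /Ck0P gc; apply/Ck0P => x; apply: cvgD; [exact: fc|exact: gc].
move=> /CkSP[fd fC] /CkSP[gd gC]; apply/CkSP; split=> [x|v].
  exact: differentiableD.
rewrite (_ : (fun x => _) = fun x => 'd f x v + 'd g x v); first exact: IH.
by apply/funext => x; rewrite diffD.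
Qed.

Lemma iterDD k f g vs x : Ck k f -> Ck k g -> (size vs <= k)%N ->
  iterD (fun x => f x + g x) vs x = iterD f vs x + iterD g vs x.
Proof.
elim/last_ind: vs k f g => [//|vs v IH] [|k] f g; rewrite size_rcons //.
move=> /CkSP[fd fC] /CkSP[gd gC] vsk; rewrite !iterD_rcons -(IH k) //.
by congr iterD; apply/funext => y; rewrite diffD.
Qed.

Lemma iterDZ k (c : R) f vs x : Ck k f -> (size vs <= k)%N ->
  iterD (fun x => c *: f x) vs x = c *: iterD f vs x.
Proof.
elim/last_ind: vs k f => [//|vs v IH] [|k] f; rewrite size_rcons //.
move=> /CkSP[fd fC] vsk; rewrite !iterD_rcons -(IH k) //.
by congr iterD; apply/funext => y; rewrite diffZ.
Qed.

Lemma Ck_sum k (I : Type) (s : seq I) (F : I -> M -> W) :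
  (forall i, Ck k (F i)) -> Ck k (fun x => \sum_(i <- s) F i x).
Proof.
move=> FC; elim: s => [|i s IH].
  by under eq_fun do rewrite big_nil; exact: Ck_cst.
by under eq_fun do rewrite big_cons; exact: CkD.
Qed.

Lemma Ck_linear k (f : {linear M -> W}) : continuous f -> Ck k f.
Proof.
move=> fc; case: k => [|k]; first exact/Ck0P.
apply/CkSP; split=> [x|v]; first exact: linear_differentiable.
rewrite (_ : (fun x => _) = fun=> f v); first exact: Ck_cst.
by apply/funext => x; rewrite diff_lin.
Qed.

End IteratedDerivatives.

Section Products.
Context (R : realType) (M W : normedModType R).
Implicit Types (f : M -> W) (r q : M -> R).

Lemma scaler_is_bilinear : bilinear_for
    (GRing.Scale.Law.clone _ _ *:%R _) (GRing.Scale.Law.clone _ _ *:%R _)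
    (@GRing.scale R W).
Proof.
split=> [w|w] a x y /=; first by rewrite scalerDl scalerA.
by rewrite scalerDr !scalerA mulrC.
Qed.
HB.instance Definition _ := bilinear_isBilinear.Build R R W W _ _
  (@GRing.scale R W) scaler_is_bilinear.

Lemma diff_scale r f x : differentiable r x -> differentiable f x ->
  differentiable (fun x => r x *: f x) x /\
  'd (fun x => r x *: f x) x = (fun v => 'd r x v *: f x + r x *: 'd f x v)
    :> (M -> W).
Proof.
move=> rd fd.
have sc : continuous (fun p : R * W => p.1 *: p.2).
  by move=> p; exact: scale_continuous.
have bd p : differentiable (fun p : R * W => p.1 *: p.2) p.
  exact: (@differentiable_bilin _ _ _ _ (@GRing.scale R W)).
have pd : differentiable (fun y => (r y, f y)) x by exact: differentiable_pair.
split; first exact: (differentiable_comp pd (bd _)).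
have := diff_comp pd (bd _).
rewrite (@diff_bilin _ _ _ _ (@GRing.scale R W)) // diff_pair // => ->.
by apply/funext => v /=; rewrite addrC.
Qed.

Lemma Ck_scale k r f : Ck k r -> Ck k f -> Ck k (fun x => r x *: f x).
Proof.
elim: k r f => [|k IH] r f.
  by move=> /Ck0P rc /Ck0P fc; apply/Ck0P => x; apply: cvgZ; [exact: rc|exact: fc].
move=> rC fC; have [rd rC'] := proj1 (CkSP _ _) rC.
have [fd fC'] := proj1 (CkSP _ _) fC.
apply/CkSP; split=> [x|v].
  by have [] := diff_scale (rd x) (fd x).
rewrite (_ : (fun x => _) = fun x => 'd r x v *: f x + r x *: 'd f x v).
  by apply: CkD; apply: IH => //; exact: CkW.
by apply/funext => x; have [_ ->] := diff_scale (rd x) (fd x).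
Qed.

End Products.

Section Composition.
Context (R : realType) (M W W' : normedModType R).

Lemma Ck_linear_comp k (L : {linear W -> W'}) (f : M -> W) :
  continuous L -> Ck k f -> Ck k (fun x => L (f x)).
Proof.
move=> Lc; elim: k f => [|k IH] f.
  by move=> /Ck0P fc; apply/Ck0P => x; apply: (continuous_comp (fc x)); exact: Lc.
move=> /CkSP[fd fC]; apply/CkSP; split=> [x|v].
  by apply: (differentiable_comp (fd x)); exact: linear_differentiable.
rewrite (_ : (fun x => _) = fun x => L ('d f x v)); first exact: IH.
apply/funext => x; rewrite (diff_comp (fd x)) ?diff_lin//.
exact: linear_differentiable.
Qed.

End Composition.

Lemma Ck_oneB (R : realType) (M : normedModType R) k (q : M -> R) :
  Ck k q -> Ck k (fun x => 1 - q x).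
Proof.
move=> qC; rewrite (_ : (fun x => _) = fun x => 1 + (- 1) *: q x).
  by apply: CkD; [exact: Ck_cst|apply: Ck_scale => //; exact: Ck_cst].
by apply/funext => x; rewrite scaleN1r.
Qed.

Lemma Ck_prod (R : realType) (M : normedModType R) k (I : Type) (s : seq I)
  (F : I -> M -> R) :
  (forall i, Ck k (F i)) -> Ck k (fun x => \prod_(i <- s) F i x).
Proof.
move=> FC; elim: s => [|i s IH].
  by under eq_fun do rewrite big_nil; exact: Ck_cst.
by under eq_fun do rewrite big_cons; exact: Ck_scale.
Qed.

(** * Truncated powers of a real function *)

Section Bump.
Context (R : realType).

Definition pos_part (t : R) : R := Num.max 0 t.

Lemma pos_part_continuous : continuous pos_part.
Proof.
move=> x; apply: (@continuous_max _ _ (fun=> 0) id).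
  exact: cst_continuous.
exact: id.
Qed.

Lemma pos_part_le0 (t : R) : t <= 0 -> pos_part t = 0.
Proof. by move=> t0; rewrite /pos_part max_l. Qed.

Lemma pos_part_sq_diff (t : R) : differentiable (fun t => pos_part t ^+ 2) t /\
  'd (fun t => pos_part t ^+ 2) t = (fun v => v * (2 * pos_part t)) :> (R -> R).
Proof.
(* The difference quotient differs from its limit by at most [|h|]: after multiplication by [h], the
   error is bounded by [h ^+ 2] for each choice of signs of [t] and [h + t]. *)
have H : (fun h : R => h^-1 *: (((fun t => pos_part t ^+ 2) \o shift t) (h *: 1)
    - pos_part t ^+ 2)) @ 0^' --> 2 * pos_part t.
  apply/cvgrPdist_le => e e0; near=> h.
  have h0 : h != 0 by near: h; exact: nbhs_dnbhs_neq.
  have he : `|h| <= e by near: h; apply: dnbhs0_le.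
  rewrite /= /GRing.scale/= mulr1.
  have -> : 2 * pos_part t - h^-1 * (pos_part (h + t) ^+ 2 - pos_part t ^+ 2)
     = h^-1 * (2 * pos_part t * h - (pos_part (h + t) ^+ 2 - pos_part t ^+ 2)).
    by field.
  rewrite normrM normfV ler_pdivrMl ?normr_gt0//.
  apply: le_trans (_ : `|h| * `|h| <= _); last by rewrite ler_wpM2l.
  rewrite -normrM ler_norml ger0_norm -?expr2 ?sqr_ge0// /pos_part.
  by apply/andP; split; case: (lerP 0 t) => t0;
    case: (lerP 0 (h + t)) => ht0; nra.
have dv : derivable (fun t => pos_part t ^+ 2) t 1.
  by apply/cvg_ex; eexists; exact: H.
have df := (proj1 (derivable1_diffP _ _) dv).
split => //; apply/funext => v.
rewrite deriv1E // derive1E.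
by rewrite /derive (cvg_lim _ H).
Unshelve. all: by end_near. Qed.

Context (M : normedModType R).
Implicit Types q : M -> R.

(* Equal to [pos_part (q x) ^+ k.+1]. Only the last factor is not smooth in [q x],
   and [t * pos_part t = pos_part t ^+ 2] is differentiable. *)
Definition pos_part_exp k q (x : M) : R := q x ^+ k * pos_part (q x).

(** The power rule: differentiation lowers the exponent of the positive part by one, from [k.+2] to
    [k.+1]. *)
Lemma diff_pos_part_exp k q x : differentiable q x ->
  differentiable (pos_part_exp k.+1 q) x /\
  'd (pos_part_exp k.+1 q) x = (fun v => k.+2%:R * pos_part_exp k q x * 'd q x v)
   :> (M -> R).
Proof.
move=> qd.
have E : pos_part_exp k.+1 q = (fun t => t ^+ k * pos_part t ^+ 2) \o q.
  apply/funext => y; rewrite /pos_part_exp /pos_part /=.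
  by case: (lerP 0 (q y)) => _; rewrite ?mulr0 ?expr0n ?mulr0// exprS expr2; ring.
have [sd sE] := pos_part_sq_diff (q x).
have hd : differentiable (fun t : R => t ^+ k * pos_part t ^+ 2) (q x) /\
   'd (fun t : R => t ^+ k * pos_part t ^+ 2) (q x) =
     (fun v => k.+2%:R * (q x ^+ k * pos_part (q x)) * v) :> (R -> R).
  case: k {E} => [|k].
    rewrite (_ : (fun t : R => _) = (fun t => pos_part t ^+ 2)).
      by split=> //; rewrite sE; apply/funext => v; ring.
    by apply/funext => t; rewrite expr0 mul1r.
  have pd : is_diff (q x) (fun t : R => t ^+ k.+1)
      (fun v => k.+1%:R * q x ^+ k *: v).
    rewrite (_ : (fun t : R => t ^+ k.+1) = id ^+ k.+1); last first.
      by rewrite exprfctE.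
    exact: (@is_diffX R _ id id k (q x)).
  have pdd : differentiable (fun t : R => t ^+ k.+1) (q x) by [].
  have pE : 'd (fun t : R => t ^+ k.+1) (q x) =
      (fun v => k.+1%:R * q x ^+ k *: v) :> (R -> R) by exact: diff_val.
  split; first exact: (differentiableM pdd sd).
  rewrite (diffM pdd sd) sE pE; apply/funext => v.
  transitivity (q x ^+ k.+1 * (v * (2 * pos_part (q x))) +
    pos_part (q x) ^+ 2 * (k.+1%:R * q x ^+ k * v)); first by [].
  rewrite /pos_part -!natr1.
  by case: (lerP 0 (q x)) => _; rewrite ?exprS; ring.
rewrite E; split; first exact: (differentiable_comp qd hd.1).
by rewrite (diff_comp qd hd.1) hd.2.
Qed.

(** Each derivative costs one exponent, so an exponent [k.+1] leaves a continuous positive part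
    after [k] of them. *)
Lemma Ck_pos_part_exp k q : Ck k q -> Ck k (pos_part_exp k q).
Proof.
elim: k q => [|k IH] q.
  move=> /Ck0P qc; apply/Ck0P => x.
  rewrite (_ : pos_part_exp 0 q = pos_part \o q); last first.
    by apply/funext => y; rewrite /pos_part_exp expr0 mul1r.
  by apply: continuous_comp; [exact: qc|exact: pos_part_continuous].
move=> qC; have [qd qC'] := proj1 (CkSP _ _) qC.
apply/CkSP; split=> [x|v]; first by have [] := diff_pos_part_exp k (qd x).
rewrite (_ : (fun x => _) = fun x => k.+2%:R *: (pos_part_exp k q x *: 'd q x v)).
  apply: Ck_scale; first exact: Ck_cst.
  by apply: Ck_scale => //; apply: IH; exact: CkW.
apply/funext => x; have [_ ->] := diff_pos_part_exp k (qd x).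
by rewrite /GRing.scale/= mulrA.
Qed.

End Bump.

Lemma scalel_fun_continuous (R : realType) (M W : normedModType R)
  (s : M -> R) (w : W) : continuous s -> continuous (fun x => s x *: w).
Proof. by move=> sc x; apply: cvgZr_tmp; exact: sc. Qed.

(** * Column vectors: compact balls and bounds on derivatives *)

Section ColumnVectors.
Context (R : realType) (m : nat).
Local Notation cV := 'cV[R]_m.
Implicit Types x v : cV.

Lemma cV_sum_delta x : x = \sum_i x i ord0 *: delta_mx i ord0.
Proof.
by rewrite {1}[x]matrix_sum_delta; apply: eq_bigr => i _; rewrite big_ord1.
Qed.

Lemma cV_coord_le x i : `|x i ord0| <= `|x|.
Proof.
rewrite [leRHS]/Num.norm /= mx_normrE; apply/bigmax_geP; right.
by exists (i, ord0).
Qed.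

Lemma cV_linear_continuous (W : normedModType R) (f : {linear cV -> W}) :
  continuous f.
Proof.
rewrite (_ : (f : _ -> _) = fun x => \sum_i x i ord0 *: f (delta_mx i ord0)).
  apply: (@Ck_continuous _ _ _ 0); apply: Ck_sum => i; apply/Ck0P.
  exact/scalel_fun_continuous/coord_continuous.
apply/funext => x; rewrite {1}[x]cV_sum_delta linear_sum.
by apply: eq_bigr => i _; rewrite linearZ.
Qed.

(** In the sup norm the ball is a cube, the transpose of a product of segments. *)
Lemma cV_ball_compact (r : R) : 0 <= r -> compact [set x : cV | `|x| <= r].
Proof.
move=> r0; have -> : [set x : cV | `|x| <= r] = (fun y : 'rV[R]_m => y^T) @`
    [set y : 'rV[R]_m | forall i, y ord0 i \in `[-r, r]].
  apply/seteqP; split=> [x /= xr|_ [y /= yr <-]].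
    exists x^T; last by rewrite trmxK.
    by move=> i; rewrite mxE in_itv/= -ler_norml (le_trans (cV_coord_le _ _)).
  rewrite /Num.norm/= mx_normrE; apply/bigmax_leP; split=> // -[i j] _ /=.
  by rewrite mxE ord1 ler_norml; have := yr i; rewrite in_itv.
apply: continuous_compact; last first.
  apply: (@rV_compact _  _ (fun=> `[-r, r]%classic)).
  by move=> _; apply: segment_compact.
apply: continuous_subspaceT.
rewrite (_ : (fun y : 'rV[R]_m => y^T) =
    fun y => \sum_i y ord0 i *: delta_mx i ord0).
  apply: (@Ck_continuous _ _ _ 0); apply: Ck_sum => i; apply/Ck0P.
  exact/scalel_fun_continuous/coord_continuous.
apply/funext => y; rewrite [LHS]cV_sum_delta.
by apply: eq_bigr => i _; rewrite mxE.
Qed.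

(** Squared Euclidean norm: the bumps are built from it because, unlike the sup norm, it is
    smooth. *)
Definition sqnorm x : R := \sum_i x i ord0 ^+ 2.

Lemma Ck_sqnorm k (M : normedModType R) (f : M -> cV) :
  Ck k f -> Ck k (fun y => sqnorm (f y)).
Proof.
move=> fC; apply: Ck_sum => i.
have lin : linear (fun x : cV => x i ord0 : R) by move=> c x y; rewrite !mxE.
pose cM := GRing.isLinear.Build _ _ _ _ _ lin.
pose cL : {linear cV -> R} := HB.pack (fun x : cV => x i ord0 : R) cM.
have fiC : Ck k (fun y => f y i ord0 : R).
  by have := Ck_linear_comp (@cV_linear_continuous R cL) fC.
rewrite (_ : (fun y => _) = fun y => f y i ord0 *: (f y i ord0 : R)).
  exact: Ck_scale.
by apply/funext => y; rewrite expr2.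
Qed.

Lemma sqnorm_ge0 x : 0 <= sqnorm x.
Proof. by apply: sumr_ge0 => i _; exact: sqr_ge0. Qed.

Lemma sqnorm_eq0 x : sqnorm x = 0 -> x = 0.
Proof.
move=> /eqP; rewrite psumr_eq0; last by move=> i _; exact: sqr_ge0.
move=> /allP H; apply/colP => i; rewrite mxE; apply/eqP.
by rewrite -sqrf_eq0; apply: H; rewrite mem_index_enum.
Qed.

Lemma norm_le_sqnorm x : `|x| <= 1 + sqnorm x.
Proof.
rewrite /Num.norm/= mx_normrE; apply/bigmax_leP; split=> [|[i j] _ /=].
  by rewrite addr_ge0 ?sqnorm_ge0.
rewrite ord1; apply: (@le_trans _ _ (1 + x i ord0 ^+ 2)).
  by rewrite ler_norml; apply/andP; split; nra.
rewrite lerD2l /sqnorm (bigD1 i)//= lerDl sumr_ge0// => k _; exact: sqr_ge0.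
Qed.

Context (W : normedModType R).
Implicit Types f : cV -> W.

(** A derivative at a point depends only on the values nearby, so vanishing on [U] passes from each
    order to the next. *)
Lemma iterD_eq0 k f (U : set cV) vs x : Ck k f -> open U ->
  (forall y, U y -> f y = 0) -> (size vs <= k)%N -> U x -> iterD f vs x = 0.
Proof.
move=> + Uo; elim/last_ind: vs k f => [k f _ f0 _ Ux|]; first exact: f0.
move=> vs v IH [|k] f; rewrite size_rcons // => /CkSP[fd fC] f0 vsk Ux.
rewrite iterD_rcons; apply: (IH k) => // y Uy.
rewrite -deriveE // (@near_eq_derive _ _ _ f (cst 0)) ?derive_cst//.
by near do apply: f0; exact: open_nbhs_nbhs.
Unshelve. all: by end_near. Qed.

Lemma iterD_sum k (I : Type) (s : seq I) (F : I -> cV -> W) vs x :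
  (forall i, Ck k (F i)) -> (size vs <= k)%N ->
  iterD (fun y => \sum_(i <- s) F i y) vs x = \sum_(i <- s) iterD (F i) vs x.
Proof.
move=> FC vsk; elim: s => [|i s IH].
  under eq_fun do rewrite big_nil.
  rewrite big_nil; apply: (@iterD_eq0 k _ setT) => //; first exact: Ck_cst.
  exact: openT.
under eq_fun do rewrite big_cons.
by rewrite big_cons -IH; apply: (iterDD _ (FC i) _ vsk); exact: Ck_sum.
Qed.

Lemma supp_bounded f (r : R) : continuous f ->
  (forall x, r < `|x| -> f x = 0) -> exists C, forall x, `|f x| <= C.
Proof.
move=> fc f0.
(* The radius [|r|] instead of [r] keeps the ball nonempty when [r] is negative. *)
have [|||c _ cmax] := @compact_EVT_max cV R (fun x => `|f x|)
  [set x | `|x| <= `|r|].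
- by exists 0; rewrite /= normr0.
- by apply: cV_ball_compact.
- by apply: continuous_subspaceT => x;
    apply: (continuous_comp (fc x)); exact: norm_continuous.
exists `|f c| => x; have [xr|xr] := lerP `|x| `|r|.
  by apply: cmax; rewrite inE.
by rewrite f0 ?normr0// (le_lt_trans _ xr)// ler_norm.
Qed.

(** Induction on [k]: the innermost direction is expanded in the standard basis, with coordinates at
    most 1 in absolute value, and the partial derivatives of [f] vanish outside the same ball. *)
Lemma iterD_bounded k f (r : R) : Ck k f ->
  (forall x, r < `|x| -> f x = 0) ->
  exists C, forall vs x, (size vs <= k)%N -> (forall v, v \in vs -> `|v| <= 1) ->
    `|iterD f vs x| <= C.
Proof.
have ro : open [set x : cV | r < `|x|].
  by apply: (open_comp (D := [set y | r < y])) => [x _|];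
    [exact: norm_continuous|exact: open_gt].
elim: k f => [|k IH] f fC f0.
  have [C HC] := supp_bounded (Ck_continuous fC) f0.
  by exists C => -[|//] x _ _; exact: HC.
have [C0 HC0] := supp_bounded (Ck_continuous fC) f0.
have [fd fC'] := proj1 (CkSP _ _) fC.
have /choice[C HC] : forall i : 'I_m, exists C, forall vs x, (size vs <= k)%N ->
   (forall v, v \in vs -> `|v| <= 1) ->
   `|iterD (fun y => 'd f y (delta_mx i ord0)) vs x| <= C.
  move=> i; apply: IH => // x xr.
  by apply: (@iterD_eq0 k.+1 f _ [:: delta_mx i ord0] _ fC ro).
(* [C0] bounds [f] itself; the sum bounds all derivatives of positive order. *)
exists (C0 + \sum_i C i) => vs x.
have C0_ge0 : 0 <= C0 by exact: le_trans (HC0 0).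
have C_ge0 i : 0 <= C i by apply: le_trans (HC i [::] 0 _ _).
elim/last_ind: vs => [_ _|vs v _].
  by rewrite /= (le_trans (HC0 x))// lerDl sumr_ge0.
rewrite size_rcons ltnS => vsk vs1; rewrite iterD_rcons.
rewrite (_ : (fun y => _) =
    fun y => \sum_i v i ord0 *: 'd f y (delta_mx i ord0)); last first.
  apply/funext => y; rewrite {1}[v]cV_sum_delta linear_sum.
  by apply: eq_bigr => i _; rewrite linearZ.
rewrite (@iterD_sum k) //; last by move=> i; apply: Ck_scale => //; exact: Ck_cst.
apply: (le_trans (ler_norm_sum _ _ _)); rewrite ler_wpDl// ler_sum// => i _.
rewrite (iterDZ _ _ (fC' _)) // normrZ -[leRHS]mul1r ler_pM //.
  rewrite (le_trans (cV_coord_le _ _))// vs1//.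
  by rewrite mem_rcons inE eqxx.
by apply: HC => // u uvs; rewrite vs1// mem_rcons inE uvs orbT.
Qed.

End ColumnVectors.

(** * The strong topology *)

Section Perturbation.
Context (R : realType) (gT : finGroupType) (G : {group gT}) (m : nat).
Variables (rM : mx_representation R G m) (k : nat).
Implicit Types psi : equivCk rM k.
Local Notation cV := 'cV[R]_m.

Fact perturb_Ck psi (P : cV -> cV) c : Ck k P -> Ck k (fun x => psi x + c *: P x).
Proof.
move=> PC; apply: CkD; first exact: equivCk_Ck.
by apply: Ck_scale => //; exact: Ck_cst.
Qed.

Fact perturb_equivariant psi (P : cV -> cV) c : equivariant rM rM P ->
  equivariant rM rM (fun x => psi x + c *: P x).
Proof.
move=> Pe g x gG; rewrite Pe// (equivCk_equivariant psi)//.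
by rewrite /actv mulmxDr scalemxAr.
Qed.

Definition perturb psi (P : cV -> cV) (PC : Ck k P) (Pe : equivariant rM rM P) c :=
  EquivCk (perturb_Ck psi c PC) (perturb_equivariant psi c Pe).

(** The gauge [e] may tend to 0 at infinity, but outside the ball nothing changes. On the ball [e]
    has a positive minimum and the derivatives of [P] are bounded. *)
Lemma perturb_near psi (P : cV -> cV) (PC : Ck k P) (Pe : equivariant rM rM P) r
    (U : set (equivCk rM k)) :
  (forall x, r < `|x| -> P x = 0) -> nbhs psi U ->
  \forall c \near 0^'+, U (perturb psi PC Pe c).
Proof.
move=> P0 [e [ec e0] eU].
have [C HC] := iterD_bounded PC P0.
have [|||y _ ymin] := @compact_EVT_min cV R e [set x | `|x| <= `|r|].
- by exists 0; rewrite /= normr0.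
- exact: cV_ball_compact.
- exact: continuous_subspaceT.
have ro : open [set x : cV | r < `|x|].
  by apply: (open_comp (D := [set y | r < y])) => [x _|];
    [exact: norm_continuous|exact: open_gt].
near=> c; apply: eU => x j jk.
have c0 : 0 < c by near: c; exact: nbhs_right_gt.
rewrite (_ : (fun vs => _) = fun vs : j.-tuple cV => c *: iterD P vs x); last first.
  apply/funext => vs; rewrite /Dn /=.
  have vsk : (size vs <= k)%N by rewrite size_tuple.
  rewrite (iterDD x (equivCk_Ck psi) _ vsk).
    by rewrite (iterDZ c x PC vsk) addrAC subrr add0r.
  by apply: Ck_scale => //; exact: Ck_cst.
have [xr|xr] := ltrP r `|x|.
  rewrite (_ : (fun vs => _) = fun _ : j.-tuple cV => 0 : cV).
    exact: opnorm0_lt.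
  apply/funext => vs; rewrite (iterD_eq0 PC ro) ?scaler0//.
  by rewrite size_tuple.
apply: (@le_lt_trans _ _ (c * C)%:E).
  apply: ge_ereal_sup => _ [vs vs1 <-]; rewrite lee_fin normrZ gtr0_norm//.
  apply: (ler_wpM2l (ltW c0)); apply: HC => [|v]; first by rewrite size_tuple.
  move=> /tnthP[i ->]; exact: vs1.
rewrite lte_fin; apply: (@lt_le_trans _ _ (e y)); last first.
  by apply: ymin; rewrite inE/= (le_trans xr)// ler_norm.
(* The factor [|C| + 1] is positive whatever [C] is, so one may divide by it. *)
apply: (@le_lt_trans _ _ (c * (`|C| + 1))).
  by apply: (ler_wpM2l (ltW c0)); rewrite (le_trans (ler_norm _))// lerDl.
rewrite -ltr_pdivlMr ?ltr_wpDl//; near: c; apply: nbhs_right_lt.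
by rewrite divr_gt0// ltr_wpDl.
Unshelve. all: by end_near. Qed.

(** A constant gauge gives a strong neighborhood, and its condition of order 0 already controls the
    values uniformly. *)
Lemma equivCk_open (O : set (equivCk rM k)) :
  (forall psi, O psi -> \forall e \near 0^'+, forall psi' : equivCk rM k,
     (forall x, `|psi' x - psi x| < e) -> O psi') -> open O.
Proof.
move=> H; rewrite openE => psi /H Oe.
have [e [e0 He]] : exists e : R, 0 < e /\ (forall psi' : equivCk rM k,
    (forall x, `|psi' x - psi x| < e) -> O psi').
  near (0 : R)^'+ => e; exists e; split; last by near: e.
  by near: e; exact: nbhs_right_gt.
exists (fun=> e); first by split=> // x; exact: cst_continuous.
move=> psi' psi'e; apply: He => x.
have := @opnorm_ltP _ _ _ 0 _ [tuple] e (psi'e x 0%N (leq0n k)).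
by rewrite /Dn /=; apply => -[].
Unshelve. all: by end_near. Qed.

(** By compactness the distance from [L1 (psi x)] to the points [L2 (psi z)] has a positive minimum;
    the Lipschitz constants of [L1] and [L2] tell how small [e] must be compared with it. *)
Lemma separation_open (W : normedModType R) (L1 L2 : {linear cV -> W})
    (K : set cV) psi x : compact K ->
  (forall z, K z -> L1 (psi x) <> L2 (psi z)) ->
  \forall e \near 0^'+, forall psi' : equivCk rM k,
     (forall x, `|psi' x - psi x| < e) ->
     forall z, K z -> L1 (psi' x) <> L2 (psi' z).
Proof.
move=> Kc KL; have [K0|K0] := pselect (K !=set0); last first.
  by near=> e; move=> psi' _ z Kz; case: K0; exists z.
have L1c := @cV_linear_continuous _ _ _ L1.
have L2c := @cV_linear_continuous _ _ _ L2.
have [k1 k10 Hk1] := linear_lipschitz L1c.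
have [k2 k20 Hk2] := linear_lipschitz L2c.
have psic : continuous psi by exact: Ck_continuous (equivCk_Ck psi).
have [|y yK ymin] := @compact_EVT_min cV R
  (fun z => `|L1 (psi x) - L2 (psi z)|) K K0 Kc.
  apply: continuous_subspaceT => z.
  apply: (@continuous_comp _ _ _ (fun z => L1 (psi x) - L2 (psi z)) Num.norm);
    last exact: norm_continuous.
  apply: continuousB; first exact: cst_continuous.
  by apply: (continuous_comp (psic z)); exact: L2c.
have {}KL : 0 < `|L1 (psi x) - L2 (psi y)|.
  by rewrite normr_gt0 subr_eq0; apply/eqP/KL; rewrite inE in yK.
near=> e => psi' psi'e z Kz E.
have := ymin z (mem_set Kz); apply/negP; rewrite -ltNge.
(* A coincidence for [psi'] would turn the distance for [psi] into a mere error term, below the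
   minimum. *)
have -> : L1 (psi x) - L2 (psi z) = L1 (psi x - psi' x) - L2 (psi z - psi' z).
  by rewrite (linearB L1) (linearB L2) E opprB addrA subrK.
apply: (le_lt_trans (ler_normB _ _)).
apply: (@le_lt_trans _ _ (k1 * e + k2 * e)).
  by apply: lerD; [apply: (le_trans (Hk1 _))|apply: (le_trans (Hk2 _))];
    apply: ler_wpM2l; rewrite ltW// distrC.
rewrite -mulrDl mulrC -ltr_pdivlMr ?addr_gt0//; near: e; apply: nbhs_right_lt.
by rewrite divr_gt0 ?addr_gt0.
Unshelve. all: by end_near. Qed.

End Perturbation.

(** * Group actions and equivariant bumps *)

Section Representation.
Context (R : realType) (gT : finGroupType) (G : {group gT}) (n : nat).
Variable rG : mx_representation R G n.
Local Notation cV := 'cV[R]_n.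
Local Notation act := (actv rG).
Implicit Types (x y : cV) (g h : gT).

Lemma actvM g h x : g \in G -> h \in G -> act (g * h)%g x = act g (act h x).
Proof. by move=> gG hG; rewrite /actv repr_mxM// mulmxA. Qed.

Lemma actv1 x : act 1%g x = x.
Proof. by rewrite /actv repr_mx1 mul1mx. Qed.

Lemma actvK g x : g \in G -> act g^-1 (act g x) = x.
Proof. by move=> gG; rewrite -actvM ?groupV// mulVg actv1. Qed.

Lemma actvVK g x : g \in G -> act g (act g^-1 x) = x.
Proof. by move=> gG; rewrite -actvM ?groupV// mulgV actv1. Qed.

Lemma actvD g x y : act g (x + y) = act g x + act g y.
Proof. exact: mulmxDr. Qed.

Lemma actvZ g c x : act g (c *: x) = c *: act g x.
Proof. by rewrite /actv scalemxAr. Qed.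

Lemma actv_sum g (I : Type) (s : seq I) (p : pred I) (F : I -> cV) :
  act g (\sum_(i <- s | p i) F i) = \sum_(i <- s | p i) act g (F i).
Proof. by rewrite /actv mulmx_sumr. Qed.

Lemma stabZ c x : c != 0 -> stab rG (c *: x) = stab rG x.
Proof.
move=> c0; apply/setP => g; rewrite !inE actvZ; congr (_ && _).
by apply/eqP/eqP => [/(scalerI c0)|->].
Qed.

Lemma actv_continuous g : continuous (act g).
Proof. exact: (@cV_linear_continuous _ _ _ (mulmx (rG g))). Qed.

(** Applied to inverses, the common constant shows that all translates of a distant point are
    distant, which bounds the supports of the bumps. *)
Lemma actv_bounded :
  exists2 K, 0 <= K & forall g x, `|act g x| <= K * `|x|.
Proof.
have /choice[K HK] : forall g, exists K, 0 <= K /\ forall x, `|act g x| <= K * `|x|.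
  move=> g; have [K K0 HK] := linear_lipschitz
    (@cV_linear_continuous _ _ _ (mulmx (rG g))).
  by exists K; split; [exact: ltW|exact: HK].
exists (\sum_g K g); first by apply: sumr_ge0 => g _; have [] := HK g.
move=> g x; have [_ Kg] := HK g; apply: (le_trans (Kg x)).
rewrite ler_wpM2r// (bigD1 g)//= lerDl; apply: sumr_ge0 => h _.
by have [] := HK h.
Qed.

Variable T : {set gT}.

(* Positive at [y] iff some translate of [y] is fixed by no element of
   [G :\: T]; the sum over translates makes it [G]-invariant. *)
Definition displacement y : R :=
  \sum_(g in G) \prod_(h in G :\: T) `|act h (act g y) - act g y|.

Lemma displacement_act g y : g \in G -> displacement (act g y) = displacement y.
Proof.
move=> gG; rewrite /displacement [RHS](reindex_inj (mulIg g)) /=.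
apply: eq_big => [h|h hG]; first by rewrite groupMr.
by apply: eq_bigr => h' _; rewrite actvM// -(groupMr _ gG).
Qed.

Lemma displacementZ c y : 0 <= c ->
  displacement (c *: y) = c ^+ #|G :\: T| * displacement y.
Proof.
move=> c0; rewrite /displacement mulr_sumr; apply: eq_bigr => g _.
rewrite -prodr_const -big_split; apply: eq_bigr => h _ /=.
by rewrite !actvZ -scalerBr normrZ ger0_norm.
Qed.

Lemma displacement_continuous : continuous displacement.
Proof.
apply: (@Ck_continuous _ _ _ 0); rewrite /displacement.
under eq_fun do rewrite -big_enum.
apply: Ck_sum => g; under eq_fun do rewrite -big_enum.
apply: Ck_prod => h; apply/Ck0P => y.
apply: (@continuous_comp _ _ _ (fun y => act h (act g y) - act g y) Num.norm);
  last exact: norm_continuous.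
apply: (@continuousB _ _ _ (act h \o act g) (act g)); last exact: actv_continuous.
by apply: continuous_comp; exact: actv_continuous.
Qed.

Lemma displacement_gt0 y : (forall g, g \in G :\: T -> act g y <> y) ->
  0 < displacement y.
Proof.
move=> yT; rewrite /displacement (bigD1 1%g)//= ltr_pwDl//.
  by apply: prodr_gt0 => h hT; rewrite normr_gt0 subr_eq0 actv1; exact/eqP/yT.
by apply: sumr_ge0 => g _; exact: prodr_ge0.
Qed.

(** A nonzero term gives [g] such that the stabilizer of [act g y] lies in [T]. It is a conjugate of
    [stab rG y], so the latter has at most [#|T|] elements; containing [T], it equals [T]. *)
Lemma stab_displacement y : T \subset stab rG y -> 0 < displacement y ->
  stab rG y = T.
Proof.
move=> Ty y0; have [g gG gy] : exists2 g, g \in G &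
    forall h, h \in G :\: T -> act h (act g y) <> act g y.
  apply: contrapT => H; move: y0; rewrite /displacement big1 ?ltxx// => g gG.
  apply: contrapT => /eqP /prodf_neq0 gy; apply: H; exists g => // h hT.
  by apply/eqP; rewrite -subr_eq0 -normr_eq0; exact: gy.
apply/esym/eqP; rewrite eqEcard Ty /=.
rewrite -(cardJg (stab rG y) g^-1); apply: subset_leq_card.
apply/fintype.subsetP => _ /imsetP[h + ->]; rewrite inE => /andP[hG /eqP hy].
have cG : (h ^ g^-1)%g \in G by rewrite groupJ ?groupV.
apply: contrapT => /negP cT; apply: (gy (h ^ g^-1)%g); first by rewrite inE cT.
by rewrite conjgE invgK !actvM ?groupM ?groupV// actvK// hy.
Qed.

End Representation.

(** * Compactly supported equivariant and invariant bumps *)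

Section Bumps.
Context (R : realType) (gT : finGroupType) (G : {group gT}) (m : nat).
Variable rM : mx_representation R G m.
Local Notation cV := 'cV[R]_m.
Local Notation act := (actv rM).

Lemma Ck_act_sub k g a : Ck k (fun z => act g z - a).
Proof.
apply: (@CkD _ _ _ _ _ (fun=> - a)); last exact: Ck_cst.
exact: (Ck_linear k (@cV_linear_continuous _ _ _ (mulmx (rM g)))).
Qed.

Definition bump k (C : R) (a z : cV) : R :=
  pos_part_exp k (fun z => 1 - C * sqnorm (z - a)) z.

Lemma bump_center k C a : bump k C a a = 1.
Proof.
rewrite /bump /pos_part_exp subrr /sqnorm big1 ?mulr0 ?subr0 ?expr1n ?mul1r.
  by rewrite /pos_part max_r.
by move=> i _; rewrite mxE expr0n.
Qed.

Lemma bump_eq0 k C a z : 1 <= C * sqnorm (z - a) -> bump k C a z = 0.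
Proof. by move=> h; rewrite /bump /pos_part_exp pos_part_le0 ?mulr0// subr_le0. Qed.

(** A bump at [a] with value [w] is summed over its translates by [G]. It is narrow enough to vanish
    on the rest of the orbit of [a], so only the stabilizer contributes at [a]. *)
Lemma equivariant_bump k (a w : cV) : exists P : cV -> cV,
  [/\ Ck k P, equivariant rM rM P,
      exists r, forall x, r < `|x| -> P x = 0 &
      P a = \sum_(g in stab rM a) act g w].
Proof.
(* [C] dominates the inverse squared distance from [a] to each other point of its orbit; elements
   fixing [a] contribute 0, the inverse of 0. The summand 1 serves the bound on the support. *)
pose C : R := 1 + \sum_(g in G) (sqnorm (act g^-1 a - a))^-1.
have iv0 g : 0 <= (sqnorm (act g^-1 a - a))^-1 by rewrite invr_ge0 sqnorm_ge0.
have C1 : 1 <= C by rewrite lerDl sumr_ge0.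
exists (fun z => \sum_(g in G) bump k C a (act g^-1 z) *: act g w); split.
- under eq_fun do rewrite -big_enum.
  apply: Ck_sum => g; apply: Ck_scale; last exact: Ck_cst.
  apply: (@Ck_pos_part_exp R _ k (fun z => 1 - C * sqnorm (act g^-1 z - a))).
  apply: Ck_oneB; apply: (@Ck_scale _ _ _ _ (fun=> C)); first exact: Ck_cst.
  by apply: Ck_sqnorm; exact: Ck_act_sub.
- move=> h z hG; rewrite actv_sum (reindex_inj (mulgI h)) /=.
  apply: eq_big => [g|g hgG]; first by rewrite groupMl.
  have gG : g \in G by rewrite -(groupMl g hG).
  by rewrite actvZ invMg !actvM ?groupV// actvK.
- have [K K0 HK] := actv_bounded rM.
  exists (K * (2 + `|a|)) => x xr; apply: big1 => g gG.
  rewrite bump_eq0 ?scale0r//.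
  have : 2 + `|a| < `|act g^-1 x|.
    rewrite ltNge; apply/negP => le; move: xr; rewrite ltNge => /negP; apply.
    rewrite -{1}(actvVK rM x gG) (le_trans (HK _ _))//.
    exact: ler_wpM2l.
  have := norm_le_sqnorm (act g^-1 x - a); have := lerB_dist (act g^-1 x) a.
  have := sqnorm_ge0 (act g^-1 x - a).
  nra.
- rewrite [RHS]big_mkcond [LHS]big_mkcond /=; apply: eq_bigr => g _.
  rewrite inE; case: ifP => //= gG; case: eqP => [ga|ga].
    by rewrite -{2}ga actvK// bump_center scale1r.
  rewrite bump_eq0 ?scale0r//.
  have s0 : 0 < sqnorm (act g^-1 a - a).
    rewrite lt_neqAle sqnorm_ge0 andbT eq_sym; apply/eqP => /sqnorm_eq0/eqP.
    by rewrite subr_eq0 => /eqP E; apply: ga; rewrite -{1}E actvVK.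
  rewrite -ler_pdivrMr// div1r /C (bigD1 g)//= addrCA lerDl addr_ge0//.
  exact: sumr_ge0.
Qed.

(** The product [Q] of the squared distances from the translates of [z] to [x] is invariant and
    vanishes exactly on the orbit of [x]; [rho] is the truncated power of [1 - Q]. *)
Lemma invariant_bump k (x : cV) : exists rho : cV -> R,
  [/\ Ck k rho, forall g z, g \in G -> rho (act g z) = rho z,
      exists r, forall z, r < `|z| -> rho z = 0,
      rho x = 1 &
      forall z, 0 <= rho z <= 1 /\
        (rho z = 1 -> exists2 g, g \in G & act g z = x)].
Proof.
pose Q z := \prod_(g in G) sqnorm (act g z - x).
have Q0 z : 0 <= Q z by apply: prodr_ge0 => g _; exact: sqnorm_ge0.
exists (pos_part_exp k (fun z => 1 - Q z)); split.
- apply: Ck_pos_part_exp; apply: Ck_oneB.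
  rewrite /Q; under eq_fun do rewrite -big_enum.
  apply: Ck_prod => g; apply: Ck_sqnorm; exact: Ck_act_sub.
- move=> g z gG; rewrite /pos_part_exp (_ : Q (act g z) = Q z)//.
  rewrite /Q [RHS](reindex_inj (mulIg g)) /=.
  apply: eq_big => [h|h hG]; first by rewrite groupMr.
  by rewrite actvM.
- have [K K0 HK] := actv_bounded rM.
  (* Beyond this radius every translate of [z] is at distance more than 2 from [x], so each factor
     of [Q z] is at least 1. *)
  exists (K * (2 + `|x|)) => z zr.
  rewrite /pos_part_exp pos_part_le0 ?mulr0// subr_le0.
  apply: (@le_trans _ _ (\prod_(g in G) 1)); first by rewrite big1_eq.
  apply: ler_prod => g gG; rewrite ler01 /=.
  have : 2 + `|x| < `|act g z|.
    rewrite ltNge; apply/negP => le; move: zr; rewrite ltNge => /negP; apply.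
    rewrite -{1}(actvK rM z gG) (le_trans (HK _ _))//.
    exact: ler_wpM2l.
  have := norm_le_sqnorm (act g z - x); have := lerB_dist (act g z) x.
  lra.
- have -> : pos_part_exp k (fun z => 1 - Q z) x = 1 ^+ k * pos_part 1; last first.
    by rewrite expr1n mul1r /pos_part max_r.
  rewrite /pos_part_exp (_ : Q x = 0) ?subr0// /Q (bigD1 1%g)//= actv1 subrr.
  by rewrite /sqnorm big1 ?mul0r// => i _; rewrite mxE expr0n.
- move=> z; rewrite /pos_part_exp; have := Q0 z.
  have [Qz1|Qz1] := lerP 1 (Q z).
    by rewrite pos_part_le0 ?subr_le0// mulr0 lexx ler01; split=> //
      /esym/eqP; rewrite oner_eq0.
  rewrite /pos_part max_r; last by rewrite subr_ge0 ltW.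
  have q0 : 0 <= 1 - Q z by rewrite subr_ge0 ltW.
  move=> Qz0; rewrite -exprSr; split.
    by rewrite exprn_ge0//= exprn_ile1// gerBl.
  move=> /eqP; rewrite pexpr_eq1// => /eqP Qz.
  have /eqP/prodf_eq0[g gG /eqP/sqnorm_eq0/eqP] : Q z = 0 by lra.
  by rewrite subr_eq0 => /eqP gz; exists g.
Qed.

End Bumps.

(** * Genericity *)

Section Generic.
Context (R : realType) (gT : finGroupType) (G : {group gT}) (m n : nat).
Variables (rM : mx_representation R G m) (rV : mx_representation R G n).
Variable phi : {linear 'cV[R]_m -> 'cV[R]_n}.
Hypothesis phi_equivariant : equivariant rM rV phi.
Variable A : set 'cV[R]_m.
Hypothesis hA : calA rM A.
Variable a : 'cV[R]_m.
Hypothesis Aa : A a.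
Hypothesis ha : stab rM a = pointwise_symm rM A.
Variable k : nat.
Local Notation T := (pointwise_symm rM A).
Implicit Types psi : equivCk rM k.

Lemma pointwise_symmP g : reflect (g \in G /\ forall x, A x -> actv rM g x = x)
  (g \in T).
Proof. by rewrite inE; apply: (iffP andP) => -[gG /asboolP]. Qed.

Lemma setwise_symmP g : reflect (g \in G /\ actv rM g @` A = A)
  (g \in setwise_symm rM A).
Proof. by rewrite inE; apply: (iffP andP) => -[gG /asboolP]. Qed.

Lemma setwise_symm_meet g x : g \in G -> A x -> A (actv rM g x) ->
  g \in setwise_symm rM A.
Proof.
move=> gG Ax Agx; apply/setwise_symmP; split=> //.
have [//|gA0] := (proj2 hA) g gG.
have : (actv rM g @` A `&` A) (actv rM g x) by split=> //; exists x.
by rewrite gA0.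
Qed.

Lemma pointwise_setwise g : g \in T -> g \in setwise_symm rM A.
Proof.
move=> /pointwise_symmP[gG gA].
by apply: (@setwise_symm_meet g a gG Aa); rewrite gA.
Qed.

Lemma phi_psi_act psi g x : g \in G ->
  phi (psi (actv rM g x)) = actv rV g (phi (psi x)).
Proof. by move=> gG; rewrite (equivCk_equivariant psi)// phi_equivariant. Qed.

Definition generic_point psi := forall g, g \in G -> g \notin T ->
  actv rV g (phi (psi a)) <> phi (psi a).

(** Non-inclusion of the translate by [g] in the image of [A], phrased as one point against a
    compact set so that [separation_open] applies. *)
Definition generic_set psi := forall g, g \in G -> g \notin setwise_symm rM A ->
  exists2 x, A x & forall z, A z -> actv rV g (phi (psi x)) <> phi (psi z).

(** For each [g], [separation_open] is applied to [phi] followed by [g] and to [phi], on [[set a]]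
    for the first condition and on [A] for the second. As the group is finite, one [e] serves all
    [g]. *)
Lemma generic_open : open [set psi | generic_point psi /\ generic_set psi].
Proof.
apply: equivCk_open => psi [p1 p2].
have H1 g : \forall e \near 0^'+, g \in G -> g \notin T ->
    forall psi' : equivCk rM k, (forall x, `|psi' x - psi x| < e) ->
    actv rV g (phi (psi' a)) <> phi (psi' a).
  have [/andP[gG gT']|/negP H] := boolP ((g \in G) && (g \notin T)); last first.
    by near=> e => gG gT'; case: H; apply/andP.
  apply: filterS (@separation_open _ _ _ _ rM k _ (mulmx (rV g) \o phi) phi
    [set a] psi a (@compact_set1 _ a) _) => [e He _ _ psi' psi'e|z ->].
    by apply: (He psi' psi'e a).
  exact: p1.
have H2 g : \forall e \near 0^'+, g \in G -> g \notin setwise_symm rM A ->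
    forall psi' : equivCk rM k, (forall x, `|psi' x - psi x| < e) ->
    exists2 x, A x & forall z, A z -> actv rV g (phi (psi' x)) <> phi (psi' z).
  have [/andP[gG gA]|/negP H] :=
      boolP ((g \in G) && (g \notin setwise_symm rM A)); last first.
    by near=> e => gG gA; case: H; apply/andP.
  have [x Ax xz] := p2 g gG gA.
  apply: filterS (@separation_open _ _ _ _ rM k _ (mulmx (rV g) \o phi) phi
    A psi x (proj1 hA) xz) => e He _ _ psi' psi'e.
  by exists x => // z; exact: He.
have F1 := filter_forall _ H1; have F2 := filter_forall _ H2.
near=> e => psi' psi'e; split=> g gG gn.
  by move: g gG gn psi' psi'e; near: e; exact: F1.
by move: g gG gn psi' psi'e; near: e; exact: F2.
Unshelve. all: by end_near. Qed.

Lemma generic_point_dense psi U v0 : (exists w, phi w = v0) -> T = stab rV v0 ->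
  nbhs psi U -> exists2 psi' : equivCk rM k, U psi' & generic_point psi'.
Proof.
move=> [w phiw] Tv0 psiU.
have [P [PC Pe [r Pr] Pa]] := equivariant_bump rM k a w.
have := perturb_near PC Pe Pr psiU => Uc.
pose t : R := #|T|%:R.
have t0 : t != 0.
  by rewrite pnatr_eq0 -lt0n; apply/card_gt0P; exists 1%g;
    apply/pointwise_symmP; split=> // x _; rewrite actv1.
(* [P a] is the sum of the translates of [w] by [T], and [phi] sends each of them to [v0], which [T]
   fixes. *)
have phiPa : phi (P a) = t *: v0.
  rewrite Pa linear_sum ha (eq_bigr (fun=> v0)) => [|g gT'].
    by rewrite sumr_const scaler_nat.
  have /pointwise_symmP[gG _] := gT'.
  rewrite phi_equivariant// phiw.
  by move: gT'; rewrite Tv0 inE gG => /eqP.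
suff H : \forall c \near 0^'+, forall g, g \in G -> g \notin T ->
    actv rV g (phi (psi a + c *: P a)) <> phi (psi a + c *: P a).
  near (0 : R)^'+ => c; exists (perturb psi PC Pe c); first by near: c.
  by near: c.
apply: filter_forall => g.
pose u := phi (psi a).
(* That [g] fixes the perturbed point means [b + c *: d = 0]. Since [d] is nonzero, at most one [c]
   satisfies this, so all small positive [c] avoid it. *)
pose b := actv rV g u - u.
pose d := t *: (actv rV g v0 - v0).
have [gT'|gT'] := boolP (g \in T); first by near=> c.
have [gG|gG] := boolP (g \in G); last by near=> c.
have d0 : d != 0.
  rewrite scaler_eq0 (negbTE t0) /= subr_eq0; apply: contra gT'.
  by rewrite Tv0 inE gG.
have bcd c : actv rV g (phi (psi a + c *: P a)) = phi (psi a + c *: P a) ->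
    b = - (c *: d).
  rewrite linearD linearZ phiPa => /eqP; rewrite -subr_eq0 => /eqP E.
  apply/eqP; rewrite -addr_eq0 -E.
  by rewrite /= actvD !actvZ opprD addrACA -!scalerBr.
have [b0|b0] := eqVneq b 0.
  near=> c => _ _ /bcd/esym/eqP; rewrite b0 oppr_eq0 scaler_eq0 (negbTE d0) orbF.
  by apply/negP; rewrite gt_eqF//; near: c; exact: nbhs_right_gt.
near=> c => _ _ /bcd /(congr1 Num.norm); rewrite normrN normrZ.
have c0 : 0 < c by near: c; exact: nbhs_right_gt.
apply/eqP; rewrite gtr0_norm// gt_eqF// -ltr_pdivlMr ?normr_gt0//.
by near: c; apply: nbhs_right_lt; rewrite divr_gt0 ?normr_gt0.
Unshelve. all: by end_near. Qed.

Lemma generic_set_dense psi U : generic_point psi -> nbhs psi U ->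
  exists2 psi' : equivCk rM k, U psi' & generic_point psi' /\ generic_set psi'.
Proof.
move=> p1 psiU.
have Tstab x : A x -> T \subset stab rV (phi (psi x)).
  move=> Ax; apply/fintype.subsetP => g /pointwise_symmP[gG gA].
  by rewrite inE gG /= -phi_psi_act// gA.
pose N y := displacement rV T y.
have phic : continuous phi by exact: cV_linear_continuous.
have psic : continuous psi by exact: Ck_continuous (equivCk_Ck psi).
have [|x xA xmax] := @compact_EVT_max _ R (fun z => N (phi (psi z))) A
    (ex_intro _ a Aa) (proj1 hA).
  apply: continuous_subspaceT => z.
  apply: (@continuous_comp _ _ _ (phi \o psi) N);
    last exact: displacement_continuous.
  by apply: (continuous_comp (psic z)); exact: phic.
rewrite inE in xA.
(* [N] is positive at the image of [a] by [generic_point], hence at the maximum, and the stabilizer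
   there is exactly [T]. *)
have Nx : 0 < N (phi (psi x)).
  apply: lt_le_trans (xmax a (mem_set Aa)); apply: displacement_gt0 => g.
  by rewrite finset.inE => /andP[gT' gG]; exact: p1.
have stabx := stab_displacement (Tstab x xA) Nx.
have [rho [rhoC rhoG [r rhor] rhox rho1]] := invariant_bump rM k x.
(* Adding [c *: P] multiplies [psi] by the positive function [1 + c * rho]. This keeps the
   stabilizers, hence [generic_point], and multiplies [N] by a power of that function. *)
pose P z := rho z *: psi z.
have PC : Ck k P by apply: Ck_scale => //; exact: equivCk_Ck.
have Pe : equivariant rM rM P.
  by move=> g z gG; rewrite /P rhoG// (equivCk_equivariant psi)// actvZ.
have Pr z : r < `|z| -> P z = 0 by move=> /rhor; rewrite /P => ->; rewrite scale0r.
have [c [c0 Uc]] : exists c : R, 0 < c /\ U (perturb psi PC Pe c).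
  near (0 : R)^'+ => c; exists c; split; first by near: c; exact: nbhs_right_gt.
  by near: c; exact: (perturb_near PC Pe Pr psiU).
set psi' := perturb psi PC Pe c in Uc.
have psi'E z : phi (psi' z) = (1 + c * rho z) *: phi (psi z).
  by rewrite /= /P scalerA linearD linearZ scalerDl scale1r.
have rho0 z : 0 <= rho z by have [/andP[]] := rho1 z.
have crho z : 0 < 1 + c * rho z by rewrite ltr_wpDr// mulr_ge0// ltW.
have Npsi' z : N (phi (psi' z)) =
    (1 + c * rho z) ^+ #|G :\: T| * N (phi (psi z)).
  by rewrite psi'E /N displacementZ// ltW.
exists psi' => //; split.
  move=> g gG gT' E; apply: (p1 g gG gT'); move: E.
  rewrite psi'E actvZ => /scalerI; apply; exact: lt0r_neq0.
move=> g gG gA; exists x => // z Az E.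
have gT' : g \notin T by apply: contra gA; exact: pointwise_setwise.
(* The exponent in the homogeneity of [N] is positive, so powers can be compared through their
   bases. *)
have card0 : (0 < #|G :\: T|)%N.
  by apply/card_gt0P; exists g; rewrite finset.inE gT'.
(* Invariance of [N] equates its values at the images of [x] and [z] under [psi']. As [x] maximizes
   it for [psi], the factor [1 + c * rho z] is at least [1 + c]. *)
have rhoz : rho z = 1.
  apply: le_anti; have [/andP[_ ->] _] := rho1 z => /=.
  have := displacement_act rV T (phi (psi' x)) gG.
  rewrite -!/(N _) E !Npsi' rhox mulr1 => NE.
  have : (1 + c) ^+ #|G :\: T| <= (1 + c * rho z) ^+ #|G :\: T|.
    rewrite -(ler_pM2r Nx) -NE; apply: ler_wpM2l;
      last by apply: xmax; exact: mem_set.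
    by rewrite exprn_ge0// ltW.
  rewrite ler_pXn2r ?nnegrE ?(ltW (crho z)) ?addr_ge0 ?(ltW c0)//.
  by rewrite lerD2l -{1}[c]mulr1 ler_pM2l.
have [_ /(_ rhoz)[h hG hz]] := rho1 z.
(* [g] carries the image of [x] to that of [z], and [h] carries it back because [act h z = x]; so
   [h * g] fixes the image of [x]. *)
have hg : (h * g)%g \in T.
  rewrite -stabx -(stabZ rV (phi (psi x)) (lt0r_neq0 (crho x))) -psi'E.
  by rewrite inE groupM//= actvM// E -phi_psi_act// hz.
have /pointwise_symmP[_ /(_ x xA) hgx] := hg.
case/negP: gA; apply: (@setwise_symm_meet g x) => //.
suff -> : actv rM g x = z by [].
by rewrite -(actvK rM z hG) hz -[in RHS]hgx actvM// actvK.
Unshelve. all: by end_near. Qed.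

End Generic.

(** * Density by two successive perturbations, and the three equalities of symmetry groups *)

Theorem theorem2p6 (R : realType) (gT : finGroupType) (G : {group gT})
    (m n : nat)
    (rM : mx_representation R G m) (rV : mx_representation R G n)
    (phi : {linear 'cV[R]_m -> 'cV[R]_n})
    (phi_equivariant : equivariant rM rV phi)
    (phi_onto : forall y : 'cV[R]_n, exists x : 'cV[R]_m, phi x = y)
    (A : set 'cV[R]_m) (hA : calA rM A)
    (hT : isotropy_subgroup rV (pointwise_symm rM A))
    (a : 'cV[R]_m) (Aa : A a) (ha : stab rM a = pointwise_symm rM A)
    (k : nat) (k_gt0 : (0 < k)%N) :
  exists O : set (equivCk rM k),
    [/\ open O, dense O &
      forall psi : equivCk rM k, O psi ->
        [/\ stab rV (phi (psi a)) = stab rM a,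
            pointwise_symm rV (phi @` (psi @` A)) = pointwise_symm rM A &
            setwise_symm rV (phi @` (psi @` A)) = setwise_symm rM A]].
Proof.
have [v0 Tv0] := hT.
exists [set psi | generic_point rV phi A a psi /\ generic_set rV phi A psi].
split; first exact: generic_open.
  move=> U [psi Upsi] Uo.
  have psiU : nbhs psi U by exact: open_nbhs_nbhs.
  have [psi1 U1 p1] :=
    generic_point_dense phi_equivariant ha (phi_onto v0) Tv0 psiU.
  (* [U] is open, so the second perturbation can start from [psi1] and stay in [U]. *)
  have psi1U : nbhs psi1 U by exact: open_nbhs_nbhs.
  have [psi2 U2 p2] := generic_set_dense phi_equivariant hA Aa p1 psi1U.
  by exists psi2.
move=> psi [p1 p2].
have act g x : g \in G -> phi (psi (actv rM g x)) = actv rV g (phi (psi x)).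
  exact: phi_psi_act.
have stabE : stab rV (phi (psi a)) = stab rM a.
  apply/setP => g; rewrite !finset.inE; have [gG|//] := boolP (g \in G).
  apply/eqP/eqP => [E|E]; last by rewrite -act// E.
  have [gT'|gT'] := boolP (g \in pointwise_symm rM A); last by case: (p1 g gG gT').
  by have /pointwise_symmP[_] := gT'; apply.
split=> //; apply/setP => g.
  apply/pointwise_symmP/pointwise_symmP => -[gG gA]; split=> //.
    (* Such a [g] fixes in particular the image of [a], whose stabilizer is [T(A)]. *)
    have : g \in pointwise_symm rM A.
      rewrite -ha -stabE inE gG /=; apply/eqP/gA.
      by exists (psi a) => //; exists a.
    by move=> /pointwise_symmP[].
  by move=> _ [_ [x Ax <-] <-]; rewrite -act// gA.
apply/setwise_symmP/setwise_symmP => -[gG gA]; split=> //.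
  have [/setwise_symmP[]//|gn] := boolP (g \in setwise_symm rM A).
  have [x Ax xz] := p2 g gG gn.
  have : (actv rV g @` (phi @` (psi @` A))) (actv rV g (phi (psi x))).
    by exists (phi (psi x)) => //; exists (psi x) => //; exists x.
  by rewrite gA => -[_ [z Az <-] /esym/(xz z Az)].
apply/seteqP; split=> [_ [_ [_ [x Ax <-] <-] <-]|_ [_ [x Ax <-] <-]].
  exists (psi (actv rM g x)); last exact: act.
  by exists (actv rM g x) => //; rewrite -gA; exists x.
move: Ax; rewrite -{1}gA => -[y Ay <-]; exists (phi (psi y)); last by rewrite act.
by exists (psi y) => //; exists y.
Qed.
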